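(* Let $H$ be a simple hypergraph with $e$-index $k$, and let $P_{\mathbf{U}(H)}(x)=x^{k}+c_1x^{k-1}+\dots+c_{k-1}x+c_k$ be the characteristic polynomial of its unified matrix $\mathbf{U}(H)$. Then the following are equivalent. (i) $H$ has no odd exact cycle. (ii) $c_{2r+1}=0$ for all $r=0,1,2,\dots$ (with $2r+1\le k$). (iii) The eigenvalues of $\mathbf{U}(H)$ are symmetric with respect to the origin, i.e., if $\lambda$ is an eigenvalue of $\mathbf{U}(H)$ with multiplicity $r$, then $-\lambda$ is also an eigenvalue of $\mathbf{U}(H)$ with the same multiplicity $r$.
   Context: A hypergraph $H$ consists of a finite non-empty vertex set $V(H)$ and a multiset $E(H)$ of non-empty subsets of $V(H)$, called edges. It is simple if it has no loops (edges of cardinality one) and no multiple edges. A 2-partition of a set $e$ is an unordered pair $\{S,S'\}$ of non-empty disjoint sets with $S\cup S'=e$; $S$ and $S'$ are called parts of $e$. $I(H)$ is the set of all parts of all edges of $H$ together with all singleton subsets of $V(H)$, and $k=|I(H)|$ is the $e$-index of $H$. For simple $H$, the unified matrix $\mathbf{U}(H)$ is the $k\times k$ matrix indexed by $I(H)$ whose $(S,S')$ entry is $1$ if $\{S,S'\}$ is a 2-partition of an edge of $H$, and $0$ otherwise. The characteristic polynomial of a square matrix $M$ is $P_M(x)=\det(xI-M)$. An exact walk in $H$ is a sequence $S_0,e_1,S_1,e_2,\dots,e_n,S_n$ such that $\{S_{i-1},S_i\}$ is a 2-partition of the edge $e_i$ of $H$ for each $i$; its length is $n$. An exact cycle is an exact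 walk with at least three distinct edges, with $S_0=S_n$ and with the parts $S_0,S_1,\dots,S_{n-1}$ pairwise distinct. It is odd if its length $n$ is odd. *)

(* Defs.v *)
From HB Require Import structures.
From mathcomp Require Import all_boot all_order all_algebra.
From mathcomp Require Import finmap multiset.

Set Implicit Arguments.
Unset Strict Implicit.
Unset Printing Implicit Defensive.

Import GRing.Theory.
Local Open Scope ring_scope.

Record hypergraph := Hypergraph {
  vertex : finType;
  edges : {mset {set vertex}}%mset;
  vertex_gt0 : (0 < #|vertex|)%N;
  edges_neq0 : set0 \notin edges
}.

Section Hypergraph.
Variable H : hypergraph.
Implicit Types (S e : {set vertex H}) (w : seq ({set vertex H} * {set vertex H})).

(* [edges H e] is the multiplicity of [e] in the multiset [edges H]. *)
Definition simple_hypergraph : Prop :=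
  (forall e, e \in edges H -> #|e| != 1%N) /\ (forall e, (edges H e <= 1)%N).

Definition two_partition e S S' : bool :=
  [&& S != set0, S' != set0, [disjoint S & S'] & S :|: S' == e].

Definition parts : {set {set vertex H}} :=
  [set S | [exists e, exists S', (e \in edges H) && two_partition e S S']].

Definition index_set : {set {set vertex H}} :=
  parts :|: [set [set v] | v : vertex H].

Definition e_index : nat := #|index_set|.

(* Rows and columns follow the enumeration of [index_set] by [enum_val]. *)
Definition unified_matrix (R : nzRingType) : 'M[R]_e_index :=
  \matrix_(i, j)
    [exists e, (e \in edges H) && two_partition e (enum_val i) (enum_val j)]%:R.

(* The walk S_0, e_1, S_1, ..., e_n, S_n is encoded by S_0 and the sequence   *)
(* w = [:: (e_1, S_1); ...; (e_n, S_n)], so that its length is [size w].      *)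
(* Edges are given by their vertex sets, which is unambiguous when H is       *)
(* simple.                                                                    *)
Fixpoint exact_walk S0 w : bool :=
  if w is (e, S1) :: w' then
    [&& e \in edges H, two_partition e S0 S1 & exact_walk S1 w']
  else true.

(* [belast S0 (unzip2 w)] is the sequence S_0, ..., S_(n-1). *)
Definition exact_cycle S0 w : bool :=
  [&& exact_walk S0 w,
      (3 <= size (undup (unzip1 w)))%N,
      last S0 (unzip2 w) == S0
    & uniq (belast S0 (unzip2 w))].

Definition has_odd_exact_cycle : Prop :=
  exists S0 w, exact_cycle S0 w /\ odd (size w).

End Hypergraph.

(* For M of size k, the c_i in det(xI - M) = x^k + c_1 x^(k-1) + ... + c_k;   *)
(* only meaningful for i <= k.                                                *)
Definition char_coef (R : nzRingType) (k : nat) (M : 'M[R]_k) (i : nat) : R :=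
  (char_poly M)`_(k - i).

(* Multiplicities are algebraic: [mup a p] is the multiplicity of a as a root  *)
(* of p.                                                                      *)
Definition symmetric_spectrum (F : fieldType) (k : nat) (M : 'M[F]_k) : Prop :=
  forall (a : F) (r : nat),
    eigenvalue M a /\ mup a (char_poly M) = r ->
    eigenvalue M (- a) /\ mup (- a) (char_poly M) = r.

(* Main.v *)
Require Import Defs.
From HB Require Import structures.
From mathcomp Require Import all_boot all_order all_algebra all_fingroup.
From mathcomp Require Import finmap multiset.

Set Implicit Arguments.
Unset Strict Implicit.
Unset Printing Implicit Defensive.

Import GRing.Theory Num.Theory.
Local Open Scope ring_scope.

(** The matrix [U(H)] is the adjacency matrix of the loopless graph on [I(H)]
    in which [S] and [S'] are joined when they are the two parts of an edge.
    The odd exact cycles of [H] are exactly the odd cycles of this graph.  The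
    one point to check is the requirement of three distinct edges.  Consecutive
    edges [S_(i-1) :|: S_i] and [S_i :|: S_(i+1)] of a cycle of parts differ,
    for otherwise [S_(i-1)] and [S_(i+1)] would both be the complement of [S_i]
    in the same edge; and a closed sequence of odd length whose neighbouring
    terms differ takes at least three values ([odd_cycle_three_colors]).

    By the Leibniz formula, the coefficient [c_n] is, up to the sign [(-1)^n],
    the sum of the signatures of the permutations of [I(H)] that displace
    exactly [n] points and displace each of them along an arrow of the graph
    ([char_coef_digraph]).  If [n] is odd, such a permutation has a nontrivial
    orbit of odd size, and that orbit is an odd cycle: without odd cycles the
    sum is empty and [c_n = 0].  Conversely, if [n] is the length of a shortest
    odd cycle, this orbit must be the whole set of displaced points, so every
    permutation in the sum is an [n]-cycle, of signature 1.  The shortest cycle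
    itself contributes a term, hence [c_n] is minus a positive integer.

    Finally, all odd coefficients of a polynomial [P] of degree [k] vanish iff
    [P(-x) = (-1)^k P(x)] ([odd_coef_comp_polyNX]).  Over an algebraically
    closed field, where [P] is the product of the [x - z] over its roots [z],
    this says that the multiset of the roots is invariant under negation. *)

(** * Permutations and cycles of a directed graph *)

Section Cycles.
Variables (T : finType) (e : rel T).
Implicit Types (s : {perm T}) (c : seq T).

Definition moved s : {set T} := [set x | s x != x].

Definition along s : bool := [forall x in moved s, e x (s x)].

Definition odd_cycle c : bool := [&& uniq c, path.cycle e c & odd (size c)].

Lemma acts_on_moved s : [acts <[s]>%g, on moved s | perm_action T].
Proof.
rewrite cycle_subG inE in_setT inE; apply/subsetP => x.
by rewrite !inE /= /aperm (inj_eq perm_inj).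
Qed.

Lemma porbit_sub_moved s x : x \in moved s -> porbit s x \subset moved s.
Proof. by rewrite porbitE acts_sub_orbit //; apply: acts_on_moved. Qed.

(** The orbits inside [moved s] partition it, and a sum of even numbers is
    even.  Such an orbit is nontrivial as it lies among moved points. *)
Lemma odd_porbit s :
  odd #|moved s| -> exists2 x, x \in moved s & odd #|porbit s x|.
Proof.
have [/exists_inP[x xs oddx] _|noodd] :=
  boolP [exists x in moved s, odd #|porbit s x|]; first by exists x.
rewrite (card_partition (orbit_partition (acts_on_moved s))).
set n := (X in odd X); suff /negPf-> : ~~ odd n by []; rewrite /n {n}.
apply: (big_ind (fun n => ~~ odd n)) => //.
  by move=> m n; rewrite oddD => /negPf-> /negPf->.
move=> _ /imsetP[x xs ->]; apply: contra noodd => oddx.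
by apply/exists_inP; exists x; rewrite // porbitE.
Qed.

(** The orbit, listed as [x, s x, s (s x), ...], is the cycle. *)
Lemma porbit_odd_cycle s x : along s -> x \in moved s -> odd #|porbit s x| ->
  odd_cycle (traject s x #|porbit s x|).
Proof.
move=> /forall_inP as_ xs oddx.
rewrite /odd_cycle uniq_traject_porbit size_traject oddx andbT /=.
have sub y : y \in traject s x #|porbit s x| -> y \in moved s.
  by rewrite -porbit_traject; apply/subsetP/porbit_sub_moved.
have := uniq_traject_porbit s x; move: sub; have := iter_porbit s x.
case: #|porbit s x| oddx => // n _ itx sub us.
have: fcycle s (traject s x n.+1).
  by rewrite /= -[x in rcons _ x]itx iterSr -trajectSr fpath_traject.
move=> fc; apply: cycle_from_next => // y ymem.
by rewrite -(eqP (next_cycle fc ymem)) as_ ?sub.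
Qed.

(** The cyclic shift along [c], which fixes the points outside [c]. *)
Definition next_perm c (uc : uniq c) : {perm T} :=
  perm (can_inj (prev_next uc)).

Hypothesis irr_e : irreflexive e.

Lemma moved_next_perm c (uc : uniq c) :
  path.cycle e c -> moved (next_perm uc) = [set x in c].
Proof.
move=> ec; apply/setP=> x; rewrite !inE permE.
have [xc|xNc] := boolP (x \in c); last by rewrite next_nth (negPf xNc) eqxx.
by apply: contraTneq (next_cycle ec xc) => ->; rewrite irr_e.
Qed.

Lemma along_next_perm c (uc : uniq c) : path.cycle e c -> along (next_perm uc).
Proof.
move=> ec; apply/forall_inP => x; rewrite moved_next_perm // inE permE.
exact: next_cycle.
Qed.

(** An odd orbit of [s] is an odd cycle, so by minimality it fills [moved s].
    Then [s] is a single cycle of odd length [n], and [s ^+ n = 1] forces its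
    signature to be 1. *)
Lemma perm_along_shortest_even s :
    along s -> odd #|moved s| ->
    (forall c, odd_cycle c -> (#|moved s| <= size c)%N) ->
  ~~ odd_perm s.
Proof.
move=> as_ odds shortest; have [x xs oddx] := odd_porbit odds.
have lesx := shortest _ (porbit_odd_cycle as_ xs oddx).
rewrite size_traject in lesx.
have eqsx : porbit s x = moved s.
  by apply/eqP; rewrite eqEcard porbit_sub_moved.
suff sn1 : (s ^+ #|moved s| = 1)%g.
  have oddX m : odd_perm (s ^+ m)%g = odd m && odd_perm s.
    elim: m => [|m IHm]; first by rewrite expg0 odd_perm1.
    by rewrite expgS odd_permM IHm /=; case: (odd m); case: (odd_perm s).
  by have := oddX #|moved s|; rewrite sn1 odd_perm1 odds /= => <-.
apply/permP => y; rewrite permX perm1.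
have [ys|] := boolP (y \in moved s).
  suff -> : moved s = porbit s y by rewrite iter_porbit.
  by rewrite -eqsx; apply/eqP; rewrite eq_porbit_mem porbit_sym eqsx.
by rewrite inE negbK => /eqP sy; elim: #|_| => //= n ->.
Qed.

End Cycles.

(** * Coefficients of the characteristic polynomial *)

(** In the Leibniz formula for [\det ('X%:M - A)], a point fixed by [s]
    contributes a factor ['X], as the diagonal of [A] is zero, and a moved point
    contributes a constant.  The term of [s] is thus a monomial of degree
    [k - #|moved s|]. *)
Lemma coef_char_poly (R : comNzRingType) k (A : 'M[R]_k) n :
    (forall i, A i i = 0) -> (n <= k)%N ->
  char_coef A n = (-1) ^+ n *
    \sum_(s : 'S_k | #|moved s| == n)
      (-1) ^+ s * \prod_(i in moved s) A i (s i).
Proof.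
move=> A0 len; rewrite /char_coef /char_poly /determinant coef_sum mulr_sumr.
rewrite [RHS]big_mkcond; apply: eq_bigr => s _ /=.
have lesk : (#|moved s| <= k)%N by rewrite -[k in leqRHS]card_ord max_card.
have -> : \prod_i char_poly_mx A i (s i) =
   'X^(k - #|moved s|) * (\prod_(i in moved s) - A i (s i))%:P.
  rewrite (bigID (mem (moved s))) /= mulrC; congr (_ * _).
    rewrite (eq_bigr (fun=> 'X)) => [|i]; last first.
      by rewrite inE negbK !mxE => /eqP->; rewrite eqxx A0 subr0.
    rewrite prodr_const; congr ('X^_).
    by apply: (@addnI #|moved s|); rewrite cardC card_ord subnKC.
  rewrite rmorph_prod; apply: eq_bigr => i; rewrite inE !mxE => si.
  by rewrite eq_sym (negPf si) sub0r rmorphN.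
rewrite -(rmorph_sign polyC) coefCM coefMC coefXn.
have -> : (k - n == k - #|moved s|)%N = (#|moved s| == n)%N.
  by rewrite eqn_sub2lE // eq_sym.
case: eqP => [<-|_]; last by rewrite mul0r mulr0.
by rewrite mul1r prodrN mulrCA.
Qed.

Section Digraph.
Variables (R : numDomainType) (k : nat) (e : rel 'I_k).
Hypothesis irr_e : irreflexive e.

Let A : 'M[R]_k := \matrix_(i, j) (e i j)%:R.

Lemma char_coef_digraph n : (n <= k)%N ->
  char_coef A n = (-1) ^+ n *
    \sum_(s : 'S_k | (#|moved s| == n) && along e s) (-1) ^+ s.
Proof.
move=> len; rewrite coef_char_poly // => [|i]; last by rewrite mxE irr_e.
congr (_ * _); rewrite big_mkcondr; apply: eq_bigr => s _.
have [/forall_inP as_|/forall_inPn[i si eNi]] := boolP (along e s).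
  by rewrite big1 ?mulr1 // => i si; rewrite mxE as_.
by rewrite (bigD1 i) //= mxE (negPf eNi) mul0r mulr0.
Qed.

(** Every permutation in the sum of [char_coef_digraph] would contain an odd
    cycle, so the sum is empty. *)
Lemma no_odd_cycle_char_coef n :
    (forall c, ~~ odd_cycle e c) -> odd n -> (n <= k)%N ->
  char_coef A n = 0.
Proof.
move=> nocycle oddn len; rewrite char_coef_digraph // big_pred0 ?mulr0 // => s.
apply: contraTF oddn => /andP[/eqP<- as_]; apply/negP => odds.
have [x xs oddx] := odd_porbit odds.
have /negP[] := nocycle (traject s x #|porbit s x|).
exact: porbit_odd_cycle.
Qed.

(** For a shortest odd cycle [c], all terms in the sum of [char_coef_digraph]
    at [n = size c] are equal to 1, and [c] itself provides one.  So the sum is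
    a positive integer, which is nonzero in characteristic 0. *)
Lemma char_coef_no_odd_cycle :
    (forall n, odd n -> (n <= k)%N -> char_coef A n = 0) ->
  forall c, ~~ odd_cycle e c.
Proof.
move=> coef0 c; have [n] := ubnP (size c).
elim: n c => // n IHn c /ltnSE lecn; apply/negP => oddc.
have shortest d : odd_cycle e d -> (size c <= size d)%N.
  apply: contraLR; rewrite -ltnNge => ltdc.
  exact: IHn (leq_trans ltdc lecn).
have /and3P[uc ec odds] := oddc.
have lec : (size c <= k)%N.
  by rewrite -(card_uniqP uc) -[k in leqRHS]card_ord max_card.
have /eqP := coef0 _ odds lec; rewrite char_coef_digraph // mulf_eq0.
rewrite signr_eq0 /= (eq_bigr (fun=> 1)) => [|s /andP[/eqP sc as_]]; last first.
  by rewrite (negPf (perm_along_shortest_even as_ _ _)) ?sc.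
rewrite sumr_const pnatr_eq0 => /eqP /card0_eq /(_ (next_perm uc)).
rewrite !inE unfold_in along_next_perm ?(moved_next_perm irr_e) //.
by rewrite cardsE (card_uniqP uc) eqxx.
Qed.

End Digraph.

(** * Polynomials with symmetric roots *)

Lemma mup_prod_XsubC (F : fieldType) (a : F) r :
  mup a (\prod_(z <- r) ('X - z%:P)) = count_mem a r.
Proof.
elim: r => [|z r IHr]; first by rewrite big_nil mupNroot // root1.
rewrite big_cons mupM ?polyXsubC_eq0 //; last first.
  by rewrite monic_neq0 ?monic_prod_XsubC.
by rewrite IHr -[_ - _]expr1 mup_XsubCX /= eq_sym; case: eqP.
Qed.

Lemma comp_polyNX_prod (F : fieldType) (r : seq F) :
  (\prod_(z <- r) ('X - z%:P)) \Po (- 'X) =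
    (-1) ^+ size r *: \prod_(z <- map -%R r) ('X - z%:P).
Proof.
rewrite big_map; elim: r => [|z r IHr].
  by rewrite !big_nil rmorph1 scale1r.
rewrite !big_cons rmorphM /= IHr comp_polyB comp_polyX comp_polyC polyCN.
rewrite exprS mulN1r scaleNr -scalerAr opprK -opprD.
by rewrite mulNr scalerN.
Qed.

Lemma coef_comp_polyNX (R : comNzRingType) (p : {poly R}) i :
  (p \Po (- 'X))`_i = (-1) ^+ i * p`_i.
Proof.
elim/poly_ind: p i => [|p c IHp] i; first by rewrite comp_poly0 !coef0 mulr0.
rewrite comp_poly_MXaddC mulrN !coefD coefN !coefMX !coefC IHp.
by case: i => [|i] /=; rewrite ?oppr0 ?mul1r // !addr0 exprS mulN1r mulNr.
Qed.

(** Comparing coefficients at ['X^(k - n)] gives [(-1)^n p`_(k-n) = p`_(k-n)]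
    after removing the common sign, an empty condition exactly for even [n]. *)
Lemma odd_coef_comp_polyNX (R : numDomainType) (p : {poly R}) k :
    size p = k.+1 ->
  (forall n, odd n -> (n <= k)%N -> p`_(k - n) = 0) <->
  p \Po (- 'X) = (-1) ^+ k *: p.
Proof.
move=> sizep; split=> [coef0|eqp n oddn len].
  apply/polyP => i; rewrite coef_comp_polyNX coefZ.
  have [leik|ltki] := leqP i k; last by rewrite nth_default ?sizep ?mulr0.
  rewrite -signr_odd -[in RHS]signr_odd.
  have -> : odd k = odd (k - i) (+) odd i by rewrite -oddD subnK.
  have [oddki|] := boolP (odd (k - i)); last by rewrite addFb.
  by rewrite -{2 4}(subKn leik) coef0 ?mulr0 // leq_subr.
have := congr1 (fun q : {poly R} => q`_(k - n)) eqp.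
rewrite coef_comp_polyNX coefZ -signr_odd -[X in _ = X * _]signr_odd.
rewrite oddB // oddn addbT; case: (odd k) => /= /eqP.
  by rewrite expr0 expr1 mul1r mulN1r eq_sym eqNr => /eqP.
by rewrite expr0 expr1 mul1r mulN1r eqNr => /eqP.
Qed.

(** The condition on eigenvalues extends to all scalars because the others have
    multiplicity 0, and negation preserves eigenvalues in both directions. *)
Lemma symmetric_spectrum_mup (F : fieldType) k (M : 'M[F]_k) :
  symmetric_spectrum M <->
  forall a, mup (- a) (char_poly M) = mup a (char_poly M).
Proof.
have root_mup a : eigenvalue M a = (0 < mup a (char_poly M))%N.
  rewrite eigenvalue_root_char -XsubC_dvd ?dvdp_XsubCl //.
  exact/monic_neq0/char_poly_monic.
split=> [sym a|eqm a r [Ma <-]]; last by rewrite root_mup eqm -root_mup.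
have [Ma|MaN] := boolP (eigenvalue M a).
  by have [] := sym a _ (conj Ma erefl).
have [MNa|] := boolP (eigenvalue M (- a)).
  by have [] := sym _ _ (conj MNa erefl); rewrite opprK (negPf MaN).
by move: MaN; rewrite !root_mup -!eqn0Ngt => /eqP-> /eqP->.
Qed.

(** With [r] the list of the roots, both sides say that [r] and
    [map -%R r] agree up to order. *)
Lemma odd_char_coef_symmetric (C : numClosedFieldType) k (M : 'M[C]_k) :
  (forall n, odd n -> (n <= k)%N -> char_coef M n = 0) <-> symmetric_spectrum M.
Proof.
rewrite symmetric_spectrum_mup.
have [r Pr] := closed_field_poly_normal (char_poly M).
have lc1 := monicP (char_poly_monic M); rewrite lc1 scale1r in Pr.
have sizeP := size_char_poly M.
have sizer : size r = k by apply: succn_inj; rewrite -sizeP Pr size_prod_XsubC.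
have mupN a : mup (- a) (char_poly M) = count_mem a (map -%R r).
  rewrite Pr mup_prod_XsubC count_map; apply: eq_count => z /=.
  by rewrite eqr_oppLR.
have mupE a : mup a (char_poly M) = count_mem a r by rewrite Pr mup_prod_XsubC.
have compP : char_poly M \Po (- 'X) =
    (-1) ^+ k *: \prod_(z <- map -%R r) ('X - z%:P).
  by rewrite Pr comp_polyNX_prod sizer.
rewrite odd_coef_comp_polyNX //; split=> [|sym].
  rewrite compP => /(inv_inj (signrZK k)) eqPr a.
  by rewrite mupN -mup_prod_XsubC -eqPr.
have eqr : perm_eq r (map -%R r).
  by apply/allP => a _ /=; rewrite -mupE -mupN sym.
by rewrite compP -(perm_big _ eqr) -Pr.
Qed.

(** * Exact cycles as cycles of a graph on the parts *)

(** The color flips at every step, so it is determined by parity. *)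
Lemma two_coloring_path (T : Type) (g : T -> bool) x p :
    path (fun a b => g a != g b) x p -> g (last x p) = odd (size p) (+) g x.
Proof.
elim: p x => //= y p IHp x /andP[gxy /IHp->].
by case: (g x) (g y) gxy => [] [] //; case: (odd _).
Qed.

(** With at most two values, the property of being equal to the first term would
    flip at each step, hence be changed after an odd number of steps. *)
Lemma odd_cycle_three_colors (T : eqType) (s : seq T) :
  path.cycle (fun a b => a != b) s -> odd (size s) -> (3 <= size (undup s))%N.
Proof.
case: s => // a p neqc oddp; rewrite ltnNge; apply/negP => le2.
have sub2 x y : x \in a :: p -> y \in a :: p -> x != y -> (x == a) != (y == a).
  move=> xs ys neqxy; apply/eqP.
  case: (eqVneq x a) (eqVneq y a) => [xa|xNa] [ya|yNa] // _.
    by rewrite xa ya eqxx in neqxy.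
  have : (size [:: a; x; y] <= size (undup (a :: p)))%N.
    apply: uniq_leq_size.
      by rewrite /= !inE negb_or eq_sym xNa eq_sym yNa neqxy.
    by apply/allP; rewrite /all !mem_undup mem_head xs ys.
  by rewrite leqNgt ltnS le2.
have : path.cycle (fun x y => (x == a) != (y == a)) (a :: p).
  by apply: (sub_in_cycle (P := mem (a :: p))) neqc => //; apply/allP.
move/(two_coloring_path (g := pred1 a)).
by rewrite last_rcons size_rcons /= eqxx -[~~ _]/(odd (size (a :: p))) oddp.
Qed.

Lemma next_next_fixed (T : eqType) (c : seq T) x :
  uniq c -> x \in c -> next c (next c x) = x -> (size c <= 2)%N.
Proof.
move=> uc /rot_to[i q rotc]; rewrite -!(next_rot i uc) -(size_rot i).
have := uc; rewrite -(rot_uniq i) rotc.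
case: q {rotc} => [|y [|z q]] //=; rewrite !inE !negb_or eqxx.
move=> /andP[/and3P[neqxy neqxz xq] /andP[/andP[neqyz yq] _]].
by rewrite (eq_sym y x) (negPf neqxy) eqxx => zx; rewrite zx eqxx in neqxz.
Qed.

Section ExactCycles.
Variable H : hypergraph.
Implicit Types (S : {set vertex H}) (c : seq {set vertex H}).

Definition adjacent S S' : bool :=
  [exists e, (e \in edges H) && two_partition e S S'].

Lemma adjacentE S S' : adjacent S S' =
  (S :|: S' \in edges H) && two_partition (S :|: S') S S'.
Proof.
apply/existsP/idP=> [[e /andP[eH part]]|]; last by exists (S :|: S').
by case/and4P: (part) => _ _ _ /eqP->; apply/andP.
Qed.

Lemma adjacent_sym S S' : adjacent S S' -> adjacent S' S.
Proof.
rewrite !adjacentE /two_partition setUC disjoint_sym eqxx.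
by move=> /andP[-> /and4P[-> -> -> _]].
Qed.

Lemma adjacent_disjoint S S' : adjacent S S' -> [disjoint S & S'].
Proof. by rewrite adjacentE => /andP[_ /and4P[]]. Qed.

Lemma adjacent_irr : irreflexive adjacent.
Proof.
move=> S; rewrite adjacentE; apply/negP => /andP[_ /and4P[S0 _ dSS _]].
by move: S0; rewrite -setI_eq0 setIid in dSS; rewrite dSS.
Qed.

Lemma adjacent_index S S' : adjacent S S' -> S \in index_set H.
Proof.
case/existsP=> e SeS'; rewrite in_setU inE; apply/orP; left.
by apply/existsP; exists e; apply/existsP; exists S'.
Qed.

(** An exact walk in which every part has a prescribed successor: this is the
    form in which a cycle of parts is turned back into a walk with edges. *)
Lemma exact_walk_map (f : {set vertex H} -> {set vertex H}) S p :
    fpath f S p -> {in S :: p, forall S', adjacent S' (f S')} ->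
  exact_walk S [seq (S' :|: f S', f S') | S' <- S :: p].
Proof.
elim: p S => [|S1 p IHp] S /=.
  by move=> _ /(_ S (mem_head _ _)); rewrite adjacentE => /andP[-> ->].
move=> /andP[/eqP fS fp] adj.
have := adj S (mem_head _ _); rewrite adjacentE => /andP[-> ->] /=.
rewrite fS; apply: IHp fp _ => S' S'p; apply: adj.
by rewrite inE S'p orbT.
Qed.

(** The edges are the unions of consecutive parts.  They satisfy the bound of
    three distinct edges because neighbouring ones differ. *)
Lemma odd_cycle_has_exact c : odd_cycle adjacent c -> has_odd_exact_cycle H.
Proof.
case/and3P=> uc adjc oddc.
have adjn S : S \in c -> adjacent S (next c S) by apply: next_cycle.
have edges3 : (3 <= size (undup [seq S' :|: next c S' | S' <- c]))%N.
  apply: odd_cycle_three_colors; rewrite ?size_map // cycle_map.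
  apply: cycle_from_next => // S Sc /=; apply/eqP => eqU.
  have nSc : next c S \in c by rewrite mem_next.
  have eqS : next c (next c S) = S.
    (* Both parts are what remains of the common edge outside [next c S]. *)
    have /setDidPl disj := adjacent_disjoint (adjn _ Sc).
    have /setDidPl ndisj := adjacent_disjoint (adjacent_sym (adjn _ nSc)).
    have := congr1 (fun e => e :\: next c S) eqU.
    by rewrite !setDUl setDv setU0 set0U disj ndisj.
  have := next_next_fixed uc Sc eqS.
  move: c uc adjc oddc Sc adjn {nSc eqU eqS}.
  case=> [|S1 [|S2 [|]]] //= _; rewrite andbT => adj.
  by rewrite adjacent_irr in adj.
case: c uc adjc oddc adjn edges3 => // S0 p uc adjc oddc adjn edges3.
pose f := next (S0 :: p).
have /andP[fp lastf] : fpath f S0 p && (f (last S0 p) == S0).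
  by have := cycle_next uc; rewrite /= rcons_path.
have belast_map q S1 : fpath f S1 q -> belast S1 (map f (S1 :: q)) = S1 :: q.
  by elim: q S1 => //= S2 q IHq S1 /andP[/eqP<- /IHq /= ->].
exists S0, [seq (S' :|: f S', f S') | S' <- S0 :: p].
rewrite /exact_cycle exact_walk_map // size_map /unzip1 /unzip2 -!map_comp.
rewrite (eq_map (_ : snd \o _ =1 f)) // belast_map // uc oddc.
by rewrite [last _ _]/= last_map lastf edges3.
Qed.

Lemma exact_walk_path S w :
  exact_walk S w -> path adjacent S (unzip2 w).
Proof.
elim: w S => //= -[e S1] w IHw S /and3P[eH part /IHw ->]; rewrite andbT.
by apply/existsP; exists e; rewrite eH.
Qed.

Lemma exact_odd_cycle :
  has_odd_exact_cycle H -> exists c, odd_cycle adjacent c.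
Proof.
case=> S [w [/and4P[/exact_walk_path walk _ lastS uw] oddw]].
have : odd (size (unzip2 w)) by rewrite size_map.
case/lastP: (unzip2 w) walk lastS uw => // p S1 walk.
rewrite last_rcons => /eqP eqS; rewrite eqS belast_rcons in walk * => uw.
by rewrite size_rcons => oddp; exists (S :: p); apply/and3P.
Qed.

(** All parts on a cycle belong to [index_set H], so the cycle can be read on
    the row indices of the unified matrix. *)
Lemma odd_cycle_enum_val :
  (exists c, odd_cycle adjacent c) <->
  (exists d, odd_cycle (relpre (@enum_val _ (mem (index_set H))) adjacent) d).
Proof.
split=> [[c /and3P[uc adjc oddc]]|[c /and3P[uc adjc oddc]]]; last first.
  exists (map enum_val c); apply/and3P; rewrite size_map cycle_map.
  by rewrite map_inj_uniq //; apply: enum_val_inj.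
have idx S : S \in c -> S \in index_set H.
  by move=> Sc; apply: adjacent_index (next_cycle adjc Sc).
case: c => // S p in uc adjc oddc idx *.
have rankK := enum_rankK_in (idx S (mem_head S p)).
pose c' := map (enum_rank_in (idx S (mem_head S p))) (S :: p).
have eqc : map enum_val c' = S :: p.
  by rewrite -map_comp map_id_in // => S' /idx; apply: rankK.
exists c'; apply/and3P; rewrite size_map -cycle_map eqc; split=> //.
by apply: (@map_uniq _ _ enum_val); rewrite eqc.
Qed.

End ExactCycles.

(** * The equivalence *)

Theorem theorem5p4 (C : numClosedFieldType) (H : hypergraph)
    (simpleH : simple_hypergraph H) :
  [<-> ~ has_odd_exact_cycle H;
       forall r : nat, (2 * r + 1 <= e_index H)%N ->
         char_coef (unified_matrix H C) (2 * r + 1) = 0;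
       symmetric_spectrum (unified_matrix H C)].
Proof.
pose e : rel 'I_(e_index H) := relpre enum_val (@adjacent H).
have irr_e : irreflexive e by move=> i; apply: adjacent_irr.
have oddE : (forall r, (2 * r + 1 <= e_index H)%N ->
      char_coef (unified_matrix H C) (2 * r + 1) = 0) <->
    (forall n, odd n -> (n <= e_index H)%N ->
      char_coef (unified_matrix H C) n = 0).
  split=> [coef0 n oddn|coef0 r]; last by apply: coef0; rewrite oddD oddM.
  by rewrite -(odd_double_half n) oddn addnC -mul2n; apply: coef0.
have cycleE : has_odd_exact_cycle H <-> exists c, odd_cycle e c.
  rewrite -odd_cycle_enum_val.
  by split=> [/exact_odd_cycle|[c /odd_cycle_has_exact]].
tfae.
- move=> nocycle; apply/oddE => n; apply: (no_odd_cycle_char_coef C irr_e) => c.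
  by apply/negP => oddc; apply/nocycle/cycleE; exists c.
- by move=> /oddE /odd_char_coef_symmetric.
move=> /odd_char_coef_symmetric coef0 /cycleE[c].
by apply/negP; apply: (char_coef_no_odd_cycle (R := C) irr_e).
Qed.
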